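(* Let $\mathcal{X},\mathcal{Y}$ be Hilbert spaces, $F:\mathcal{D}(F)\subset\mathcal{X}\to\mathcal{Y}$ an operator and $y\in\mathcal{Y}$. Assume: (a) $\Theta:\mathcal{X}\to(-\infty,\infty]$ is proper, weakly lower semi-continuous and $p$-convex for some $p>1$, i.e. there is $c_0>0$ with $D_\xi\Theta(\bar x,x)\ge c_0\|x-\bar x\|^p$ for all $\bar x\in\mathcal{D}(\Theta)$, $x\in\mathcal{D}(\partial\Theta)$, $\xi\in\partial\Theta(x)$; (b) there are $\rho>0$, $x_0\in\mathcal{X}$, $\xi_0\in\partial\Theta(x_0)$ with $B_{2\rho}(x_0)\subset\mathcal{D}(F)$, and $F(x)=y$ has a solution $x^*\in\mathcal{D}(\Theta)$ with $D_{\xi_0}\Theta(x^*,x_0)\le c_0\rho^p$; (c) $F$ is continuous and weakly closed on $\mathcal{D}(F)$; (d) there is a family of bounded linear operators $\{L(x):\mathcal{X}\to\mathcal{Y}\}_{x\in B_{2\rho}(x_0)\cap\mathcal{D}(\Theta)}$, with $x\mapsto L(x)$ continuous on $B_{2\rho}(x_0)\cap\mathcal{D}(\Theta)$, a number $0\le\eta<1$ with $\|F(x)-F(\bar x)-L(\bar x)(x-\bar x)\|<\eta\|F(x)-F(\bar x)\|$ for all $x,\bar x\in B_{2\rho}(x_0)\cap\mathcal{D}(\Theta)$, and $C_0>0$ with $\|L(x)\|\le C_0$ for all $x\in B_{2\rho}(x_0)$. Let $(\xi(t),x(t))$, $t\ge0$, be the solution of the noise-free problem $$\frac{d\xi(t)}{dt}=-L(x(t))^*(F(x(t))-y),\quad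 x(t)=\nabla\Theta^*(\xi(t)),\qquad \xi(0)=\xi_0,\ x(0)=x_0.$$ Then there exists a solution $\bar x\in B_{2\rho}(x_0)\cap\mathcal{D}(\Theta)$ of $F(x)=y$ such that $\lim_{T\to\infty}\|x(T)-\bar x\|=0$.
   Context: $\partial\Theta$ is the subdifferential, $\mathcal{D}(\Theta)=\{x:\Theta(x)<\infty\}$, $\mathcal{D}(\partial\Theta)=\{x\in\mathcal{D}(\Theta):\partial\Theta(x)\ne\emptyset\}$, and $D_\xi\Theta(\bar x,x)=\Theta(\bar x)-\Theta(x)-\langle\xi,\bar x-x\rangle$ for $\xi\in\partial\Theta(x)$ is the Bregman distance. $\Theta^*$ is the Legendre–Fenchel conjugate of $\Theta$, $L(x)^*$ the adjoint, and $B_{2\rho}(x_0)$ the closed ball of radius $2\rho$ about $x_0$.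
   Formalization: In (d) the strict ''<'' is replaced by ''≤'', since at x = x̄ = x_0 the strict inequality reads 0<0 and (d) could never hold; and the bound ‖L(x)‖ ≤ C_0 is required only for x in B_{2ρ}(x_0)∩D(Θ), where L(x) is defined. *)

(* Defs.v *)
(* real Hilbert spaces modelled as complete normed
   modules over R : realType together with an inner product compatible with
   the norm. *)
From HB Require Import structures.
From mathcomp Require Import all_boot all_order all_algebra.
From mathcomp Require Import all_classical all_reals all_analysis.
Set Implicit Arguments. Unset Strict Implicit. Unset Printing Implicit Defensive.
Import Order.TTheory GRing.Theory Num.Theory.
Import numFieldNormedType.Exports.
Local Open Scope classical_set_scope.
Local Open Scope ring_scope.

Section Defs.
Variable R : realType.

Definition inner_product (X : normedModType R) (ip : X -> X -> R) : Prop :=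
  [/\ forall u v, ip u v = ip v u,
      forall a u v w, ip (a *: u + v) w = a * ip u w + ip v w &
      forall u, `|u| ^+ 2 = ip u u].

Definition weak_cvg (X : normedModType R) (ip : X -> X -> R)
  (u : nat -> X) (x : X) : Prop :=
  forall z, (fun n => ip z (u n)) @ \oo --> ip z x.

Definition cball (X : normedModType R) (x0 : X) (r : R) : set X :=
  [set x | `|x - x0| <= r].

Definition edom (X : Type) (Th : X -> \bar R) : set X :=
  [set x | (Th x < +oo)%E].

Definition proper_fun (X : Type) (Th : X -> \bar R) : Prop :=
  (forall x, Th x != -oo%E) /\ exists x, (Th x < +oo)%E.

Definition weakly_lsc (X : normedModType R) (ip : X -> X -> R)
  (Th : X -> \bar R) : Prop :=
  forall (u : nat -> X) x, weak_cvg ip u x ->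
    (Th x <= limn_einf (fun n => Th (u n)))%E.

(* subdifferential (dual identified with X through the inner product) *)
Definition subdiff (X : normedModType R) (ip : X -> X -> R)
  (Th : X -> \bar R) (x : X) : set X :=
  [set xi | Th x \is a fin_num /\
            forall z, (Th x + (ip xi (z - x))%:E <= Th z)%E].

Definition dom_subdiff (X : normedModType R) (ip : X -> X -> R)
  (Th : X -> \bar R) : set X :=
  [set x | edom Th x /\ subdiff ip Th x !=set0].

Definition bregman (X : normedModType R) (ip : X -> X -> R)
  (Th : X -> \bar R) (xi xb x : X) : \bar R :=
  (Th xb - Th x - (ip xi (xb - x))%:E)%E.

Definition conj_fun (X : normedModType R) (ip : X -> X -> R)
  (Th : X -> \bar R) (xi : X) : \bar R :=
  ereal_sup (range (fun x => ((ip xi x)%:E - Th x)%E)).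

Definition is_gradient (X : normedModType R) (ip : X -> X -> R)
  (f : X -> \bar R) (xi g : X) : Prop :=
  [/\ f xi \is a fin_num,
      \forall h \near (0 : X), f (xi + h) \is a fin_num &
      (fun h : X => (fine (f (xi + h)) - fine (f xi) - ip g h) / `|h|)
        @ (0 : X)^' --> (0 : R)].

Definition weakly_closed (X Y : normedModType R) (ipX : X -> X -> R)
  (ipY : Y -> Y -> R) (DF : set X) (F : X -> Y) : Prop :=
  forall (u : nat -> X) x v, (forall n, DF (u n)) ->
    weak_cvg ipX u x -> weak_cvg ipY (fun n => F (u n)) v ->
    DF x /\ F x = v.
End Defs.

(* Main.v *)
(* Write D_t(z) = Theta(z) - <xi(t), z> + Theta*(xi(t)), the Bregman distance
   of z to x(t).  Differentiability of Theta* at xi(t) forces xi(t) to be a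
   subgradient at x(t), so D_t(z) >= c0 |x(t) - z|^p and
   D_t'(z) = <xi'(t), x(t) - z>, which for a solution z is at most
   - (1 - eta) r(t)^2 with r = |F(x) - y|.  Hence D_t(xstar) decreases, which keeps
   x(t) in the ball, and r gets arbitrarily small.  If t is a record time of r,
   meaning that r(t) <= r(s) for all s <= t, then
   D_s(x(t)) <= K (D_s(xstar) - D_t(xstar)), so x is Cauchy along record times; its
   limit v there solves the equation, and lower semicontinuity turns the same
   bound into D_s(v) <= K (D_s(xstar) - inf_t D_t(xstar)), which tends to 0 as s grows. *)
Require Import Defs.
From HB Require Import structures.
From mathcomp Require Import all_boot all_order all_algebra.
From mathcomp Require Import all_classical all_reals all_analysis.
From mathcomp Require Import ring lra.
Import Order.TTheory GRing.Theory Num.Theory.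
Import numFieldNormedType.Exports.
Local Open Scope classical_set_scope.
Local Open Scope ring_scope.

(** * Inner product calculus *)

Section InnerProduct.
Context {R : realType} {V : normedModType R} {ip : V -> V -> R}.
Hypothesis ipP : inner_product ip.

Lemma ipC u v : ip u v = ip v u.
Proof. by case: ipP. Qed.

Lemma ipDl u v w : ip (u + v) w = ip u w + ip v w.
Proof. by case: ipP => _ lin _; rewrite -[u]scale1r lin mul1r scale1r. Qed.

Lemma ip0l w : ip 0 w = 0.
Proof. by apply: (addrI (ip 0 w)); rewrite -ipDl !addr0. Qed.

Lemma ipZl a u w : ip (a *: u) w = a * ip u w.
Proof. by case: ipP => _ lin _; rewrite -[a *: u]addr0 lin ip0l addr0. Qed.

Lemma ipNl u w : ip (- u) w = - ip u w.
Proof. by rewrite -scaleN1r ipZl mulN1r. Qed.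

Lemma ipBl u v w : ip (u - v) w = ip u w - ip v w.
Proof. by rewrite ipDl ipNl. Qed.

Lemma ipDr u v w : ip w (u + v) = ip w u + ip w v.
Proof. by rewrite ![ip w _]ipC ipDl. Qed.

Lemma ipZr a u w : ip w (a *: u) = a * ip w u.
Proof. by rewrite ![ip w _]ipC ipZl. Qed.

Lemma ipBr u v w : ip w (u - v) = ip w u - ip w v.
Proof. by rewrite ![ip w _]ipC ipBl. Qed.

Lemma ip0r w : ip w 0 = 0.
Proof. by rewrite ipC ip0l. Qed.

Lemma ipxx u : ip u u = `|u| ^+ 2.
Proof. by case: ipP. Qed.

Lemma cauchy_schwarz u v : `|ip u v| <= `|u| * `|v|.
Proof.
have [->|u0] := eqVneq u 0; first by rewrite ip0l !normr0 mul0r.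
have n0 : 0 < `|u| by rewrite normr_gt0.
rewrite -(@ler_pXn2r _ 2%N) ?nnegrE ?mulr_ge0 // real_normK ?num_real //.
(* Up to the factor -|u|^2 this vector is the component of v orthogonal to u; the scaling avoids a
   division. *)
have : 0 <= `|ip u v *: u - (`|u| ^+ 2) *: v| ^+ 2 by rewrite sqr_ge0.
rewrite -[X in 0 <= X]ipxx ipBl !ipBr !ipZl !ipZr !ipxx (ipC v u) => h.
have h2 : 0 <= `|u| ^+ 2 * ((`|u| * `|v|) ^+ 2 - ip u v ^+ 2).
  by apply: le_trans h _; rewrite le_eqVlt; apply/orP; left; apply/eqP; ring.
by move: h2; rewrite pmulr_rge0 ?exprn_gt0 // subr_ge0.
Qed.

Lemma ip_le u v : ip u v <= `|u| * `|v|.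
Proof. exact: le_trans (ler_norm _) (cauchy_schwarz u v). Qed.

Lemma ip_cvgr {T : Type} {G : set_system T} {GF : Filter G} (f : T -> V) l w :
  f @ G --> l -> (fun t => ip w (f t)) @ G --> ip w l.
Proof.
move=> fl; apply/cvgrPdist_lt => e e0.
have d0 : 0 < e / (`|w| + 1) by rewrite divr_gt0 // ltr_wpDl.
move/cvgrPdist_lt: fl => /(_ _ d0); apply: filterS => t lt.
rewrite -ipBr (le_lt_trans (cauchy_schwarz _ _)) //.
rewrite (@le_lt_trans _ _ ((`|w| + 1) * `|l - f t|)) ?ler_wpM2r ?lerDl //.
by rewrite mulrC -ltr_pdivlMr // ltr_wpDl.
Qed.

Lemma ip_cvgl {T : Type} {G : set_system T} {GF : Filter G} (f : T -> V) l w :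
  f @ G --> l -> (fun t => ip (f t) w) @ G --> ip l w.
Proof.
by move=> fl; under eq_fun do rewrite ipC; rewrite ipC; exact: ip_cvgr.
Qed.

End InnerProduct.

(** * Real analysis: monotonicity, powers, record times and lower limits *)

Lemma nonincreasing_of_derive_le0 {R : realType} (f df : R -> R) (a b : R) :
  a <= b -> {within `[a, b], continuous f} ->
  (forall t, a < t -> t < b -> is_derive t 1 f (df t) /\ df t <= 0) ->
  f b <= f a.
Proof.
move=> ab cf dfP.
apply: (@ler0_derive1_le_cc _ f a b) => //; rewrite ?in_itv /= ?lexx ?ab //.
- by move=> t; rewrite in_itv /= => /andP[ta tb]; have [] := dfP t ta tb; case.
- move=> t; rewrite in_itv /= => /andP[ta tb]; have [h d0] := dfP t ta tb.
  by rewrite derive1E (@derive_val _ _ _ _ _ _ _ h).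
Qed.

Lemma powR_le_cancel {R : realType} (p a b : R) :
  0 < p -> 0 <= a -> 0 <= b -> a `^ p <= b `^ p -> a <= b.
Proof.
move=> p0 a0 b0; rewrite !leNgt; apply: contra => ba.
by apply: gt0_ltr_powR; rewrite ?nnegrE.
Qed.

Lemma powR_lt_cancel {R : realType} (p a b : R) :
  0 <= p -> 0 <= a -> 0 <= b -> a `^ p < b `^ p -> a < b.
Proof.
move=> p0 a0 b0; rewrite !ltNge; apply: contra => ba.
by apply: ge0_ler_powR; rewrite ?nnegrE.
Qed.

(* With values of r bounded away from 0 on [0, n], a minimizer of r over a
   longer interval where r gets smaller lies beyond n. *)
Lemma exists_record {R : realType} (r : R -> R) (n e : R) :
  (forall b, 0 <= b -> {within `[0, b], continuous r}) ->
  (forall t, 0 <= t -> 0 < r t) ->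
  (forall d, 0 < d -> exists2 t, 0 <= t & r t < d) ->
  0 <= n -> 0 < e ->
  exists t, [/\ n <= t, r t < e & forall s, 0 <= s -> s <= t -> r t <= r s].
Proof.
move=> rc r0 rinf n0 e0.
have [c] := EVT_min n0 (rc _ n0); rewrite in_itv /= => /andP[c0 cn] cmin.
have d0 : 0 < Num.min e (r c) by rewrite lt_min e0 r0.
have [T T0] := rinf _ d0; rewrite lt_min => /andP[Te Tc].
have [t] := EVT_min T0 (rc _ T0); rewrite in_itv /= => /andP[t0 tT] tmin.
have rtT : r t <= r T by apply: tmin; rewrite in_itv /= T0 lexx.
exists t; split.
- rewrite leNgt; apply/negP => tn.
  have := cmin t; rewrite in_itv /= t0 ltW // => /(_ isT).
  by rewrite leNgt (le_lt_trans rtT).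
- exact: le_lt_trans Te.
- by move=> s s0 st; apply: tmin; rewrite in_itv /= s0 (le_trans st).
Qed.

Lemma limn_einf_le_cvg {R : realType} (u : nat -> \bar R) (a : nat -> R) (l : R) :
  (forall n, (u n <= (a n)%:E)%E) -> a @ \oo --> l -> (limn_einf u <= l%:E)%E.
Proof.
move=> ua al; rewrite limn_einf_lim.
have al' : (fun n => (a n)%:E) @ \oo --> l%:E by exact/cvg_EFin/al/nearW.
rewrite -(cvg_lim _ al') //; apply: lee_lim; first exact: is_cvg_einfs.
  by apply/cvg_ex; exists l%:E.
apply: nearW => n; apply: le_trans (ua n); apply: ereal_inf_lbound.
by exists n => /=.
Qed.

(** * Differentiability of the conjugate and attainment of its supremum *)

Section ConjugateGradient.
Context {R : realType} {V : normedModType R} {ip : V -> V -> R}.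
Hypothesis ipP : inner_product ip.

Lemma strong_weak_cvg (u : nat -> V) v : u @ \oo --> v -> weak_cvg ip u v.
Proof. by move=> uv w; exact: ip_cvgr. Qed.

Context {Th : V -> \bar R} {xi g : V}.
Hypothesis Th_proper : proper_fun Th.
Hypothesis gradP : is_gradient ip (conj_fun ip Th) xi g.

Lemma conj_fun_ge v zeta : ((ip zeta v)%:E - Th v <= conj_fun ip Th zeta)%E.
Proof. by apply: ereal_sup_ubound; exists v. Qed.

(** The point is paired with its real value so that [choice] can extract a maximizing sequence. A
    point where [Th] is [+oo] contributes -oo to the supremum and cannot be near-maximal. *)
Lemma conj_fun_maximizing e : 0 < e -> exists vr : V * R,
  Th vr.1 = vr.2%:E /\ fine (conj_fun ip Th xi) - e < ip xi vr.1 - vr.2.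
Proof.
move=> e0; have [Cfin _ _] := gradP.
have [_ [v _ <-]] := ub_ereal_sup_adherent e0 Cfin.
rewrite -[ereal_sup _]/(conj_fun ip Th xi) -(fineK Cfin).
case: Th_proper => ThNy _; case E : (Th v) (ThNy v) => [r| |] //= _.
by rewrite -!EFinB lte_fin => h; exists (v, r).
Qed.

(* Smulian: testing differentiability of the conjugate in the direction
   v - g shows that near-maximizers v of ip xi - Th are close to g. *)
Lemma conj_fun_near_maximizer e : 0 < e -> exists2 d : R, 0 < d &
  forall v r, Th v = r%:E -> fine (conj_fun ip Th xi) - d < ip xi v - r ->
  `|v - g| < e.
Proof.
move=> e0; have [Cfin Hfin /cvgrPdist_lt lim] := gradP.
have e20 : 0 < e / 2 by rewrite divr_gt0.
have near1 : \forall h \near (0 : V), h != 0 ->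
    `|0 - (fine (conj_fun ip Th (xi + h)) - fine (conj_fun ip Th xi) - ip g h)
          / `|h| | < e / 2 by exact: lim.
have [/nbhs_norm0P[d1 /= d10 dP1] /nbhs_norm0P[d2 /= d20 dP2]] := (near1, Hfin).
pose d := Num.min d1 d2; have d0 : 0 < d by rewrite lt_min d10.
pose k := d / 2; have k0 : 0 < k by rewrite divr_gt0.
(* Fenchel-Young at xi + h with |h| = k bounds k * |v - g| by the differentiability error e / 2 * k
   plus the maximization defect; a defect below e / 2 * k makes the sum less than k * e. *)
exists (e / 2 * k); first by rewrite mulr_gt0.
move=> v r Thv vr; set w := v - g.
have [->|w0] := eqVneq w 0; first by rewrite normr0.
have nw : 0 < `|w| by rewrite normr_gt0.
(* Only the direction of w enters: h stays within the radius d even when v is far from g. *)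
pose h := (k / `|w|) *: w.
have nh : `|h| = k.
  by rewrite /h normrZ ger0_norm ?divr_ge0 ?ltW // divfK // gt_eqF.
have h0 : h != 0 by rewrite -normr_gt0 nh.
have bh : `|h| < d by rewrite nh /k ltr_pdivrMr // mulr_natr mulr2n ltrDl.
have [bh1 bh2] : `|h| < d1 /\ `|h| < d2 by apply/andP; rewrite -lt_min.
have fh := dP2 _ bh2; have := dP1 _ bh1 h0.
rewrite sub0r normrN nh => /(le_lt_trans (ler_norm _)).
rewrite ltr_pdivrMr // => q.
have := conj_fun_ge v (xi + h).
rewrite Thv -EFinB -(fineK fh) lee_fin (ipDl ipP) => q2.
have q3 : ip h v - ip g h = k * `|w|.
  rewrite (ipC ipP g) -(ipBr ipP) -/w (ipZl ipP) (ipxx ipP) expr2 mulrA divfK //.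
  by rewrite gt_eqF.
have : k * `|w| < k * e by lra.
by rewrite ltr_pM2l.
Qed.

Hypothesis Th_lsc : weakly_lsc ip Th.

(** A maximizing sequence converges to g in norm by the Smulian argument, so lower semicontinuity
    gives one inequality; the other is Fenchel-Young. *)
Lemma conj_fun_gradient :
  Th g \is a fin_num /\ fine (Th g) + fine (conj_fun ip Th xi) = ip xi g.
Proof.
have [Cfin _ _] := gradP; set C := fine (conj_fun ip Th xi).
have npos n : 0 < n.+1%:R^-1 :> R by rewrite invr_gt0 ltr0n.
have [f fP] := choice (fun n => conj_fun_maximizing _ (npos n)).
pose u n := (f n).1.
have ug : u @ \oo --> g.
  apply/cvgrPdist_lt => e /conj_fun_near_maximizer[d d0 dP].
  have := near_infty_natSinv_lt (PosNum d0); apply: filterS => n /= nd.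
  rewrite distrC; have [h1 h2] := fP n.
  by apply: dP h1 _; apply: lt_trans h2; rewrite ltrD2l ltrN2.
have le1 : (Th g <= (ip xi g - C)%:E)%E.
  apply: le_trans (Th_lsc _ _ (strong_weak_cvg _ _ ug)) _.
  apply: (@limn_einf_le_cvg _ _ (fun n => ip xi (u n) - C + n.+1%:R^-1)).
    move=> n; have [-> h] := fP n; rewrite lee_fin /=.
    by move: h; rewrite -/C -/(u n); set a := n.+1%:R^-1; lra.
  rewrite -[X in _ --> X]addr0; apply: cvgD; last exact: cvg_harmonic.
  by apply: cvgB; [exact: (ip_cvgr ipP)|exact: cvg_cst].
have Tfin : Th g \is a fin_num.
  by rewrite fin_numE (Th_proper.1 g) /= -ltey (le_lt_trans le1) ?ltry.
split=> //; apply/eqP; rewrite eq_le; apply/andP; split.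
  by move: le1; rewrite -(fineK Tfin) lee_fin lerBrDr.
have := conj_fun_ge g xi.
by rewrite -(fineK Tfin) -(fineK Cfin) -EFinB lee_fin -/C lerBlDl.
Qed.

(** Compare the Fenchel equality at g with the Fenchel-Young inequality at z. This makes p-convexity
    applicable along the flow. *)
Lemma gradient_subdiff : subdiff ip Th g xi.
Proof.
have [Cfin _ _] := gradP.
have [Tfin e] := conj_fun_gradient; split=> // z.
have := conj_fun_ge z xi; move: e (Th_proper.1 z).
rewrite -(fineK Cfin) -(fineK Tfin); case: (Th z) => [r| |] //= e _.
  by rewrite -EFinB !lee_fin (ipBr ipP); lra.
by rewrite leey.
Qed.

End ConjugateGradient.

Lemma cvg0_of_norm_le {R : realType} {T : Type} {G : set_system T}
    {GF : Filter G} (f g : T -> R) :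
  (\forall t \near G, `|f t| <= g t) -> g @ G --> (0 : R) -> f @ G --> (0 : R).
Proof.
move=> fg g0; apply/cvgrPdist_lt => e e0.
move/cvgrPdist_lt: g0 => /(_ _ e0); apply: filterS2 fg => t ft.
rewrite !sub0r !normrN => gt; apply: le_lt_trans ft _.
exact: le_lt_trans (ler_norm _) gt.
Qed.

(** * Continuity of the primal trajectory and differentiation of Bregman distances *)

Section DualFlow.
Context {R : realType} {V : completeNormedModType R} {ip : V -> V -> R}.
Context {E : set V} {th : V -> R} {cs : R -> R} {xi dxi x : R -> V} {c0 p : R}.

(* The Bregman distance D_{xi t}(z, x t), rewritten through the Fenchel
   identity th (x t) + cs t = ip (xi t) (x t), where cs t is the conjugate
   at xi t. *)
Definition breg z t := th z - ip (xi t) z + cs t.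

Hypothesis ipP : inner_product ip.
Hypothesis c0_gt0 : 0 < c0.
Hypothesis p_gt1 : 1 < p.
Hypothesis x_dom : forall t : R, 0 <= t -> E (x t).
Hypothesis fenchel : forall t : R, 0 <= t -> th (x t) + cs t = ip (xi t) (x t).
Hypothesis breg_ge : forall (t : R) z, 0 <= t -> E z ->
  c0 * `|x t - z| `^ p <= breg z t.
Hypothesis xi_cont : {within [set t : R | 0 <= t], continuous xi}.
Hypothesis xi_derive : forall t : R, 0 < t -> is_derive t (1 : R) xi (dxi t).

Lemma breg_ge0 t z : 0 <= t -> E z -> 0 <= breg z t.
Proof.
move=> t0 zE; apply: le_trans (breg_ge _ _ t0 zE).
by rewrite mulr_ge0 ?powR_ge0 // ltW.
Qed.

(** Three-point identity, with [th (x t)] eliminated by the Fenchel identity at t. For a solution z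
    the difference of Bregman distances telescopes, so only the dual increment remains to be
    estimated. *)
Lemma breg_flow s t z : 0 <= t ->
  breg (x t) s = breg z s - breg z t + ip (xi t - xi s) (x t - z).
Proof.
move=> t0; have := fenchel _ t0.
by rewrite /breg (ipBl ipP) !(ipBr ipP); lra.
Qed.

(** Sum of the two p-convexity inequalities with the roles of s and t exchanged. *)
Lemma flow_monotone s t : 0 <= s -> 0 <= t ->
  2 * (c0 * `|x s - x t| `^ p) <= ip (xi s - xi t) (x s - x t).
Proof.
move=> s0 t0.
have := breg_ge _ _ s0 (x_dom _ t0); have := breg_ge _ _ t0 (x_dom _ s0).
rewrite (distrC (x t)) /breg (ipBl ipP) !(ipBr ipP).
by have := fenchel _ s0; have := fenchel _ t0; lra.
Qed.

(** Strong monotonicity and Cauchy-Schwarz give 2 c0 |x s - x t|^(p-1) <= |xi s - xi t|, so x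
    inherits continuity from xi. *)
Lemma flow_dist_lt e s t : 0 < e -> 0 <= s -> 0 <= t ->
  `|xi s - xi t| < 2 * (c0 * e `^ (p - 1)) -> `|x s - x t| < e.
Proof.
move=> e0 s0 t0 lt_xi; rewrite ltNge; apply: contraTN lt_xi => le_e; rewrite -leNgt.
have n0 : 0 < `|x s - x t| by exact: lt_le_trans le_e.
have p1 : 0 <= p - 1 by rewrite subr_ge0 ltW.
have le_pow : e `^ (p - 1) <= `|x s - x t| `^ (p - 1).
  by apply: ge0_ler_powR; rewrite ?nnegrE // ltW.
rewrite -(ler_pM2r n0); apply: le_trans (ip_le ipP _ _).
apply: le_trans (flow_monotone _ _ s0 t0).
rewrite -(@mulr_powRB1 _ `|x s - x t| p) //; last exact: lt_trans p_gt1.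
have := ler_wpM2l (mulr_ge0 (ltW c0_gt0) (ltW n0)) le_pow; lra.
Qed.

Lemma flow_cvg (t : R) : 0 <= t ->
  x @ within [set s : R | 0 <= s] (nbhs t) --> x t.
Proof.
move=> t0; apply/cvgrPdist_lt => e e0.
have d0 : 0 < 2 * (c0 * e `^ (p - 1)) by rewrite !mulr_gt0 // powR_gt0.
have /cvgrPdist_lt/(_ _ d0) := (subspace_continuousP _ _).1 xi_cont _ t0.
by rewrite !near_withinE; apply: filterS => s h s0; apply: flow_dist_lt => //; exact: h.
Qed.

(** The linearization error is [breg (x t) s], hence nonnegative; adding the nonnegative
    [breg (x s) t] gives [ip (xi s - xi t) (x s - x t)], which bounds it. *)
Lemma cs_err (s t : R) : 0 <= s -> 0 <= t ->
  `|cs s - cs t - ip (xi s - xi t) (x t)| <= `|xi s - xi t| * `|x s - x t|.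
Proof.
move=> s0 t0; apply: le_trans (ip_le ipP _ _).
have := breg_ge0 _ _ s0 (x_dom _ t0); have := breg_ge0 _ _ t0 (x_dom _ s0).
rewrite /breg !(ipBl ipP) !(ipBr ipP) => h1 h2.
by rewrite ger0_norm; have := fenchel _ s0; have := fenchel _ t0; lra.
Qed.

Lemma cs_cvg (t : R) : 0 <= t ->
  cs @ within [set s : R | 0 <= s] (nbhs t) --> cs t.
Proof.
move=> t0; have xt := flow_cvg _ t0.
have xit := (subspace_continuousP _ _).1 xi_cont _ t0.
have err0 : (fun s => cs s - cs t - ip (xi s - xi t) (x t)) @ within [set s : R | 0 <= s] (nbhs t) --> (0 : R).
  apply: (@cvg0_of_norm_le _ _ _ _ _ (fun s => `|xi s - xi t| * `|x s - x t|)).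
    by rewrite near_withinE; apply: nearW => s s0; exact: cs_err.
  rewrite -[X in _ --> X](_ : `|xi t - xi t| * `|x t - x t| = 0); last first.
    by rewrite !subrr normr0 mul0r.
  by apply: cvgM; apply: cvg_norm; apply: cvgB => //; exact: cvg_cst.
have lin : (fun s => ip (xi s - xi t) (x t)) @ within [set s : R | 0 <= s] (nbhs t) --> ip (xi t - xi t) (x t).
  by apply: (ip_cvgl ipP); apply: cvgB => //; exact: cvg_cst.
have : (fun s => cs s - cs t - ip (xi s - xi t) (x t) + ip (xi s - xi t) (x t) + cs t)
    @ within [set s : R | 0 <= s] (nbhs t) --> 0 + ip (xi t - xi t) (x t) + cs t.
  by apply: cvgD; [exact: cvgD|exact: cvg_cst].
rewrite subrr (ip0l ipP) !add0r => lim; apply: (cvg_trans _ lim).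
by apply: near_eq_cvg; apply: nearW => s; ring.
Qed.

Lemma ip_xi_is_derive (t : R) w : 0 < t ->
  is_derive t (1 : R) (fun s => ip (xi s) w) (ip (dxi t) w).
Proof.
move=> t0; have [der <-] := xi_derive _ t0.
have lim : (fun h => h^-1 *: (((fun s => ip (xi s) w) \o shift t) (h *: (1 : R))
    - ip (xi t) w)) @ (0 : R)^' --> ip ('D_1 xi t) w.
  have dw : (fun h => ip (h^-1 *: ((xi \o shift t) (h *: (1 : R)) - xi t)) w)
      @ (0 : R)^' --> ip ('D_1 xi t) w by exact: (ip_cvgl ipP) der.
  apply: (cvg_trans _ dw); apply: near_eq_cvg; apply: nearW => h /=.
  by rewrite (ipZl ipP) (ipBl ipP).
by split; [apply/cvg_ex; eexists; exact: lim|exact: cvg_lim lim].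
Qed.

(** Divided by the increment, the bound of [cs_err] is a convergent difference quotient of xi times
    |x(t + h) - x(t)|, so the linearization error is negligible. *)
Lemma cs_is_derive (t : R) : 0 < t -> is_derive t (1 : R) cs (ip (dxi t) (x t)).
Proof.
move=> t0; have [der derE] := xi_derive _ t0.
have shift_t : (fun h : R => h *: (1 : R) + t) @ (0 : R)^' --> t.
  rewrite -[X in _ --> X]add0r -[X in _ --> X + _](scale0r (1 : R)).
  apply: cvgD; last exact: cvg_cst.
  by apply: cvgZ; [exact: cvg_within|exact: cvg_cst].
(* The flow is controlled at nonnegative times only, so small increments that keep t + h >= 0 are
   selected. *)
have pos : \forall h \near (0 : R)^', 0 <= h *: (1 : R) + t.
  by move/cvgr_ge : shift_t => /(_ _ t0).
have xt : (fun h => x (h *: (1 : R) + t)) @ (0 : R)^' --> x t.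
  move=> P /(flow_cvg _ (ltW t0)) => Pt.
  have : \forall h \near (0 : R)^', 0 <= h *: (1 : R) + t -> P (x (h *: (1 : R) + t)).
    exact: shift_t Pt.
  by apply: filterS2 pos => h h0; exact.
have lin : (fun h => ip (h^-1 *: ((xi \o shift t) (h *: (1 : R)) - xi t)) (x t))
    @ (0 : R)^' --> ip ('D_1 xi t) (x t) by exact: (ip_cvgl ipP) der.
have err0 : (fun h => h^-1 * (cs (h *: (1 : R) + t) - cs t
    - ip (xi (h *: (1 : R) + t) - xi t) (x t))) @ (0 : R)^' --> (0 : R).
  apply: (@cvg0_of_norm_le _ _ _ _ _
    (fun h => `|h^-1 *: ((xi \o shift t) (h *: (1 : R)) - xi t)| * `|x (h *: (1 : R) + t) - x t|)).
    apply: filterS pos => h h0 /=.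
    rewrite normrM normrZ -mulrA ler_wpM2l //; apply: cs_err => //; exact: ltW.
  rewrite -[X in _ --> X](_ : `|'D_1 xi t| * `|x t - x t| = 0); last first.
    by rewrite subrr normr0 mulr0.
  apply: cvgM; apply: cvg_norm; first exact: der.
  by apply: cvgB => //; exact: cvg_cst.
have lim : (fun h => h^-1 *: ((cs \o shift t) (h *: (1 : R)) - cs t)) @ (0 : R)^'
    --> ip (dxi t) (x t).
  rewrite -derE -[X in _ --> X]addr0; apply: (cvg_trans _ (cvgD lin err0)).
  apply: near_eq_cvg; apply: nearW => h /=.
  by rewrite fctE /= (ipZl ipP) -mulrDr addrC subrK.
by split; [apply/cvg_ex; eexists; exact: lim|exact: cvg_lim lim].
Qed.

(* Every estimate along the flow is an instance: combining breg z with a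
   linear functional of xi lets differential inequalities replace integrals. *)
Lemma breg_variation z w K m a b : 0 <= a -> a <= b ->
  (forall t, a < t -> t < b -> ip (dxi t) (K *: (x t - z) + w) <= m) ->
  K * breg z b + ip (xi b) w <= K * breg z a + ip (xi a) w + m * (b - a).
Proof.
move=> a0 ab le_m.
pose f s := K * breg z s + ip (xi s) w - m * s.
suff : f b <= f a by rewrite /f; lra.
apply: (@nonincreasing_of_derive_le0 _ f
  (fun t => ip (dxi t) (K *: (x t - z) + w) - m) a b ab).
  apply/subspace_continuousP => t; rewrite /= in_itv /= => /andP[ta tb].
  have t0 : 0 <= t by exact: le_trans ta.
  (* At a = 0 only one-sided continuity is available, so limits are taken within the half-line and
     then restricted to the interval. *)
  apply: (@cvg_trans _ (f @ within [set s : R | 0 <= s] (nbhs t))).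
    move=> P; apply: within_subset => s; rewrite /= in_itv /= => /andP[+ _].
    exact: le_trans.
  have xit := (subspace_continuousP _ _).1 xi_cont _ t0.
  apply: cvgB; last by apply: cvgM; [exact: cvg_cst|exact: cvg_within].
  apply: cvgD; last exact: (ip_cvgl ipP).
  apply: cvgM; first exact: cvg_cst.
  apply: cvgD; last exact: cs_cvg.
  by apply: cvgB; [exact: cvg_cst|exact: (ip_cvgl ipP)].
move=> t ta tb; split; last by rewrite subr_le0; exact: le_m.
have t0 : 0 < t by exact: le_lt_trans ta.
have dz := ip_xi_is_derive _ z t0; have dw := ip_xi_is_derive _ w t0.
have dc := cs_is_derive _ t0.
rewrite /f /breg; apply: is_derive_eq.
rewrite (ipDr ipP) (ipZr ipP) (ipBr ipP) /GRing.scale /=; ring.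
Qed.

Lemma flow_eq_of_dual_eq s t : 0 <= s -> 0 <= t -> xi s = xi t -> x s = x t.
Proof.
move=> s0 t0 e; have := flow_monotone _ _ s0 t0.
rewrite e subrr (ip0l ipP) pmulr_rle0 // pmulr_rle0 // => le0.
have /eqP : `|x s - x t| `^ p = 0 by apply/eqP; rewrite eq_le le0 powR_ge0.
by rewrite powR_eq0 normr_eq0 subr_eq0 => /andP[/eqP].
Qed.

(** * Estimates from the tangential cone condition *)

Context {W : normedModType R} {ipW : W -> W -> R}.
Context {F : V -> W} {y : W} {L : V -> {linear V -> W}} {S : set V} {eta : R}.

Hypothesis ipWP : inner_product ipW.
Hypothesis eta_ge0 : 0 <= eta.
Hypothesis eta_lt1 : eta < 1.
Hypothesis cone : forall u v, S u -> S v ->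
  `|F u - F v - L v (u - v)| <= eta * `|F u - F v|.
Hypothesis flow_eq : forall t : R, 0 < t ->
  forall z, ip (dxi t) z = - ipW (F (x t) - y) (L (x t) z).

Definition residual t := `|F (x t) - y|.

Lemma residual_ge0 t : 0 <= residual t.
Proof. exact: normr_ge0. Qed.

(** With a = F(x t) - y, the cone condition makes L(x t)(x t - z) equal to a up to an error of norm
    at most eta |a|; pair this with -a. *)
Lemma dxi_descent (t : R) z : 0 < t -> S (x t) -> S z -> F z = y ->
  ip (dxi t) (x t - z) <= - (1 - eta) * residual t ^+ 2.
Proof.
move=> t0 Sx Sz Fz; rewrite flow_eq //.
have := cone _ _ Sz Sx; rewrite Fz -(opprB (F (x t))) normrN => le_q.
set a := F (x t) - y in le_q *; set q := - a - _ in le_q.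
have -> : L (x t) (x t - z) = q + a.
  by rewrite /q addrAC addNr sub0r -linearN opprB.
rewrite (ipDr ipWP) (ipxx ipWP) /residual -/a.
have := cauchy_schwarz ipWP a q; rewrite ler_norml => /andP[h _].
have := ler_wpM2l (normr_ge0 a) le_q.
by move: h; rewrite expr2; lra.
Qed.

(** Split u - z through x t. The cone condition gives |L(x t)(v - x t)| <= (1 + eta)|F v - F(x t)|,
    and the image difference is at most twice the residual for u and equal to it for z; hence the
    factor 3. *)
Lemma dxi_le (t : R) u z : 0 < t -> S (x t) -> S u -> S z -> F z = y ->
  `|F u - y| <= residual t ->
  `|ip (dxi t) (u - z)| <= 3 * (1 + eta) * residual t ^+ 2.
Proof.
move=> t0 Sx Su Sz Fz le_u; rewrite flow_eq // normrN.
apply: le_trans (cauchy_schwarz ipWP _ _) _.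
have coneL v : S v -> `|L (x t) (v - x t)| <= (1 + eta) * `|F v - F (x t)|.
  move=> Sv; have := cone _ _ Sv Sx; set q := _ - _ - _ => le_q.
  have -> : L (x t) (v - x t) = F v - F (x t) - q by rewrite /q opprB [RHS]addrC subrK.
  by apply: le_trans (ler_normB _ _) _; rewrite mulrDl mul1r lerD2l.
have -> : u - z = (u - x t) - (z - x t) by rewrite opprB [RHS]addrA subrK.
rewrite linearB -/(residual t).
have r0 := residual_ge0 t.
have le_Lu : `|L (x t) (u - x t)| <= (1 + eta) * (2 * residual t).
  apply: le_trans (coneL _ Su) _; rewrite ler_wpM2l ?addr_ge0 //.
  have -> : F u - F (x t) = (F u - y) - (F (x t) - y) by rewrite opprB [RHS]addrA subrK.
  apply: le_trans (ler_normB _ _) _.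
  by move: le_u; rewrite /residual; lra.
have le_Lz : `|L (x t) (z - x t)| <= (1 + eta) * residual t.
  by apply: le_trans (coneL _ Sz) _; rewrite Fz /residual distrC.
rewrite expr2 mulrCA ler_wpM2l //; apply: le_trans (ler_normB _ _) _.
by lra.
Qed.

Lemma breg_descent z a b (m : R) : 0 <= a -> a <= b -> S z -> F z = y ->
  (forall t, a < t -> t < b -> S (x t)) -> 0 <= m ->
  (forall t, a < t -> t < b -> m <= residual t) ->
  breg z b <= breg z a - (1 - eta) * m ^+ 2 * (b - a).
Proof.
move=> a0 ab Sz Fz Sx m0 le_m.
have := @breg_variation z 0 1 (- (1 - eta) * m ^+ 2) a b a0 ab.
rewrite !mul1r !(ip0r ipP) !addr0 !mulNr; apply=> t ta tb.
have t0 : 0 < t by exact: le_lt_trans ta.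
rewrite scale1r addr0; apply: le_trans (dxi_descent _ _ t0 (Sx _ ta tb) Sz Fz) _.
rewrite mulNr lerN2 ler_wpM2l ?subr_ge0 ?(ltW eta_lt1) //.
by rewrite ler_pXn2r ?nnegrE ?residual_ge0 // le_m.
Qed.

Lemma breg_nonincreasing z a b : 0 <= a -> a <= b -> S z -> F z = y ->
  (forall t, a < t -> t < b -> S (x t)) -> breg z b <= breg z a.
Proof.
move=> a0 ab Sz Fz Sx.
have := breg_descent _ _ _ _ a0 ab Sz Fz Sx (lexx 0).
rewrite expr0n mulr0 mul0r subr0; apply=> t _ _; exact: residual_ge0.
Qed.

(** The part K of the constant is chosen so that K times the descent rate of [breg z] cancels the
    bound of [dxi_le] for the direction x t - z. Then K * breg z + ip xi (x t - z) is nonincreasing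
    on [s, t], and [breg_flow] contributes the remaining 1. *)
Lemma breg_record z s t : 0 <= s -> s <= t -> S z -> F z = y ->
  (forall u, s < u -> u <= t -> S (x u)) ->
  S (x t) -> (forall u, s < u -> u <= t -> residual t <= residual u) ->
  breg (x t) s <= (1 + 3 * (1 + eta) / (1 - eta)) * (breg z s - breg z t).
Proof.
move=> s0 st Sz Fz Sx Sxt rec.
have t0 : 0 <= t by exact: le_trans st.
have e1 : 0 < 1 - eta by rewrite subr_gt0.
set K := 3 * (1 + eta) / (1 - eta).
have K0 : 0 <= K by rewrite /K divr_ge0 ?(ltW e1) // mulr_ge0 // addr_ge0.
have KE : K * (1 - eta) = 3 * (1 + eta) by rewrite /K divfK // gt_eqF.
have := @breg_variation z (x t - z) K 0 s t s0 st.
rewrite mul0r addr0 => H.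
rewrite (breg_flow _ _ z t0) (ipBl ipP) mulrDl mul1r.
suff : K * breg z t + ip (xi t) (x t - z) <= K * breg z s + ip (xi s) (x t - z).
  by lra.
apply: H => u su ut; have u0 : 0 < u by exact: le_lt_trans su.
have Sxu := Sx _ su (ltW ut).
have h1 := ler_wpM2l K0 (dxi_descent _ _ u0 Sxu Sz Fz).
have := dxi_le _ _ _ u0 Sxu Sxt Sz Fz (rec _ su (ltW ut)).
rewrite ler_norml => /andP[_ h2]; rewrite (ipDr ipP) (ipZr ipP).
by move: h1; rewrite mulrA mulrN KE; lra.
Qed.

(** Without decrease of the Bregman distance the residual must vanish on average, so xi cannot move.
    To see this without integrals, |xi t - xi 0|^2 is bounded by an arbitrarily small multiple of
    t. *)
Lemma dual_stationary z t C0 : 0 <= t -> S z -> F z = y ->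
  (forall s, 0 < s -> s < t -> S (x s)) ->
  (forall u, S u -> forall v, `|L u v| <= C0 * `|v|) -> 0 <= C0 ->
  breg z 0 <= breg z t -> xi t = xi 0.
Proof.
move=> t0 Sz Fz Sx C0P C00 le_breg; apply/eqP.
have e1 : 0 < 1 - eta by rewrite subr_gt0.
set w := xi t - xi 0; rewrite -subr_eq0 -/w -normr_eq0 -sqrf_eq0 -(ipxx ipP).
rewrite eq_le; apply/andP; split; last by rewrite (ipxx ipP) sqr_ge0.
set B := C0 * `|w|; have B0 : 0 <= B by rewrite mulr_ge0.
have bound e : 0 < e -> ip w w <= B * e * t.
  (* With this K the descent term is -B r^2 / e, which absorbs the quadratic part of B r <= B (e +
     r^2 / e). *)
  move=> e0; set K := B / (e * (1 - eta)).
  have K0 : 0 <= K by rewrite divr_ge0 // ltW // mulr_gt0.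
  have := @breg_variation z w K (B * e) 0 t (lexx 0) t0.
  rewrite subr0 => H.
  have : K * breg z t + ip (xi t) w <= K * breg z 0 + ip (xi 0) w + B * e * t.
    apply: H => s s0 st; have Sxs := Sx _ s0 st; have r0 := residual_ge0 s.
    have h1 := ler_wpM2l K0 (dxi_descent _ _ s0 Sxs Sz Fz).
    have h2 : ip (dxi s) w <= residual s * B.
      rewrite flow_eq //; apply: le_trans (ler_norm _) _; rewrite normrN.
      apply: le_trans (cauchy_schwarz ipWP _ _) _.
      by rewrite -/(residual s) ler_wpM2l // C0P.
    rewrite (ipDr ipP) (ipZr ipP); apply: le_trans (lerD h1 h2) _.
    have -> : K * (- (1 - eta) * residual s ^+ 2) = - (B * residual s ^+ 2 / e).
      by rewrite /K; field; rewrite !gt_eqF.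
    (* AM-GM: r <= e + r^2 / e *)
    have amgm : residual s <= e + residual s ^+ 2 / e.
      have [le_e|lt_e] := leP (residual s) e.
        by apply: le_trans le_e _; rewrite lerDl divr_ge0 ?sqr_ge0 ?ltW.
      apply: ler_wpDl; first exact: ltW.
      by rewrite ler_pdivlMr // expr2 ler_wpM2l // ltW.
    have := ler_wpM2l B0 amgm; rewrite mulrDr mulrA.
    by lra.
  have := ler_wpM2l K0 le_breg.
  by rewrite /w [in X in _ -> _ -> X](ipBl ipP) -/w; lra.
apply/ler_addgt0Pr => d d0; rewrite add0r.
have h0 : 0 < B * t + 1 by rewrite ltr_wpDl // mulr_ge0.
(* The choice of e makes B * e * t at most d; the summand 1 keeps the denominator positive. *)
apply: le_trans (bound (d / (B * t + 1)) _) _; first by rewrite divr_gt0.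
rewrite (_ : _ * t = d * (B * t / (B * t + 1))); last by ring.
by rewrite ger_pMr // ler_pdivrMr // mul1r lerDl.
Qed.

(** * Invariance of the ball *)

Context {z x0 : V} {rho C0 : R}.
Hypothesis SE : forall u, S u <-> `|u - x0| <= 2 * rho /\ E u.
Hypothesis rho_gt0 : 0 < rho.
Hypothesis x_init : x 0 = x0.
Hypothesis z_dom : E z.
Hypothesis z_sol : F z = y.
Hypothesis z_near : breg z 0 <= c0 * rho `^ p.
Hypothesis C0_ge0 : 0 <= C0.
Hypothesis L_bound : forall u, S u -> forall v, `|L u v| <= C0 * `|v|.

Lemma x0_sol_dist : `|x 0 - z| <= rho.
Proof.
apply: (@powR_le_cancel _ p); rewrite ?(ltW rho_gt0) ?normr_ge0 //.
  exact: lt_trans p_gt1.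
by rewrite -(ler_pM2l c0_gt0); apply: le_trans z_near; exact: breg_ge.
Qed.

Lemma sol_in_ball : S z.
Proof.
apply/SE; split=> //; have := x0_sol_dist.
by rewrite x_init distrC; move: rho_gt0; lra.
Qed.

(** The strict inequality is what a continuation argument needs. Either the Bregman distance to z
    has strictly decreased, so |x t - z| < rho while |x 0 - z| <= rho, or the dual variable has not
    moved and x t = x0. *)
Lemma flow_interior t : 0 <= t -> (forall s, 0 < s -> s < t -> S (x s)) ->
  `|x t - x0| < 2 * rho.
Proof.
move=> t0 Sx; have le0 := breg_nonincreasing _ _ _ (lexx 0) t0 sol_in_ball z_sol Sx.
have [lt|ge] := ltP (breg z t) (breg z 0); last first.
  have e := dual_stationary _ _ _ t0 sol_in_ball z_sol Sx L_bound C0_ge0 ge.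
  rewrite (flow_eq_of_dual_eq _ _ t0 (lexx 0) e) x_init subrr normr0.
  by rewrite mulr_gt0.
have lt_rho : `|x t - z| < rho.
  apply: (@powR_lt_cancel _ p); rewrite ?(ltW rho_gt0) ?normr_ge0 //.
    by rewrite ltW // (lt_trans _ p_gt1).
  rewrite -(ltr_pM2l c0_gt0); apply: lt_le_trans z_near.
  exact: le_lt_trans (breg_ge _ _ t0 z_dom) lt.
have -> : x t - x0 = (x t - z) - (x 0 - z) by rewrite x_init opprB addrA subrK.
apply: le_lt_trans (ler_normB _ _) _.
by have := x0_sol_dist; move: lt_rho; lra.
Qed.

(** Let s be the infimum of the times outside the ball. Up to s the trajectory is admissible, so x s
    is strictly interior, and by continuity no exit occurs just after s. *)
Lemma flow_in_ball (t : R) : 0 <= t -> S (x t).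
Proof.
move=> t0; apply: contrapT => nSt.
pose B := [set s : R | 0 <= s /\ 2 * rho < `|x s - x0|].
have SB (s : R) : 0 <= s -> ~ B s -> S (x s).
  move=> s0 nB; apply/SE; split; last exact: x_dom.
  by rewrite leNgt; apply/negP => lt; apply: nB.
have Bt : B t by apply: contrapT => /(SB _ t0).
have Binf : has_inf B by split; [exists t|exists 0 => s []].
set s := inf B.
have s0 : 0 <= s by apply: lb_le_inf; [exists t|move=> u []].
have ltS : `|x s - x0| < 2 * rho.
  apply: flow_interior => // u u0 us; apply: SB; first exact: ltW.
  by move=> /(ge_inf Binf.2); rewrite leNgt us.
have near_s : \forall u \near within [set s : R | 0 <= s] (nbhs s),
    `|x u - x0| < 2 * rho.
  have cvg_s : (fun u => `|x u - x0|) @ within [set s : R | 0 <= s] (nbhs s)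
      --> `|x s - x0|.
    by apply: cvg_norm; apply: cvgB; [exact: flow_cvg|exact: cvg_cst].
  exact: (cvgr_lt _ cvg_s).
move: near_s; rewrite near_withinE => /nbhs_normP[d /= d0 dP].
have [u [u0 Bu] us] := inf_adherent d0 Binf.
have su : s <= u by apply: ge_inf => //; exact: Binf.2.
have du : `|s - u| < d by rewrite distrC ger0_norm ?subr_ge0 // ltrBlDl.
by have := dP u du u0; rewrite ltNge ltW.
Qed.

(** * Vanishing residual and convergence of the trajectory *)

Hypothesis F_cont : forall u, S u -> F @ within S (nbhs u) --> F u.
Hypothesis th_lsc : forall (u : nat -> V) (a : nat -> R) v l,
  (forall n, E (u n)) -> u @ \oo --> v ->
  (forall n, th (u n) <= a n) -> a @ \oo --> l -> E v /\ th v <= l.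

Lemma residual_continuous b : {within `[0, b], continuous residual}.
Proof.
apply/subspace_continuousP => t; rewrite /= in_itv /= => /andP[t0 _].
apply: cvg_norm; apply: cvgB; last exact: cvg_cst.
have SFx := F_cont _ (flow_in_ball _ t0).
move=> P /SFx SP.
have {}SP : nbhs (x t) (fun v => S v -> P (F v)) by exact: SP.
have xP : nbhs t (fun s : R => 0 <= s -> S (x s) -> P (F (x s))).
  exact: flow_cvg SP.
have : nbhs t (fun s : R => s \in `[0, b] -> P (F (x s))).
  apply: filterS xP => s h; rewrite in_itv /= => /andP[s0 _].
  by apply: h => //; exact: flow_in_ball.
exact.
Qed.

Lemma residual_small d : 0 < d -> exists2 t, 0 <= t & residual t < d.
Proof.
move=> d0; apply: contrapT => nex.
have le_d t : 0 <= t -> d <= residual t.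
  by move=> t0; rewrite leNgt; apply/negP => lt; apply: nex; exists t.
have q0 : 0 < (1 - eta) * d ^+ 2 by rewrite mulr_gt0 ?subr_gt0 ?exprn_gt0.
(* By this time a residual of at least d would have lowered [breg z] by its initial value plus 1,
   making it negative. *)
pose T := (breg z 0 + 1) / ((1 - eta) * d ^+ 2).
have T0 : 0 <= T.
  by rewrite divr_ge0 ?(ltW q0) // addr_ge0 //; exact: breg_ge0.
have := breg_descent _ _ _ _ (lexx 0) T0 sol_in_ball z_sol
  (fun t t0 _ => flow_in_ball _ (ltW t0)) (ltW d0) (fun t t0 _ => le_d _ (ltW t0)).
rewrite subr0 [_ * T]mulrC divfK ?gt_eqF //.
by have := breg_ge0 _ _ T0 z_dom; lra.
Qed.

Lemma breg_antitone s t : 0 <= s -> s <= t -> breg z t <= breg z s.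
Proof.
move=> s0 st; apply: breg_nonincreasing => //; first exact: sol_in_ball.
by move=> u su _; apply: flow_in_ball; rewrite ltW // (le_lt_trans s0).
Qed.

Lemma breg_eventually d : 0 < d -> exists2 t, 0 <= t &
  forall s u, t <= s -> t <= u -> breg z s - breg z u < d.
Proof.
move=> d0; pose B := [set breg z t | t in [set t : R | 0 <= t]].
have Binf : has_inf B.
  by split; [exists (breg z 0); exists 0 => //=|exists 0 => _ [t /= t0 <-]; exact: breg_ge0].
have [_ [t /= t0 <-] lt] := inf_adherent d0 Binf.
exists t => // s u ts tu; have su := breg_antitone _ _ t0 ts.
have : inf B <= breg z u.
  by apply: ge_inf; [exact: Binf.2|exists u => //=; exact: le_trans tu].
by move: su lt; lra.
Qed.

(** Record times beyond any bound are produced for a positive residual, so this case is separate.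
    Here x T is itself a solution, its Bregman distance starts from 0 at time T and cannot grow, and
    the flow stays at x T. *)
Lemma flow_cvg_of_residual0 T : 0 <= T -> residual T = 0 ->
  exists2 v, S v & F v = y /\
    forall e, 0 < e -> exists2 t0, 0 <= t0 & forall t, t0 <= t -> `|x t - v| < e.
Proof.
move=> T0 /eqP; rewrite normr_eq0 subr_eq0 => /eqP FT.
have ST := flow_in_ball _ T0.
exists (x T) => //; split=> // e e0; exists T => // t Tt.
have t0 : 0 <= t by exact: le_trans Tt.
have le_0 : breg (x T) t <= 0.
  apply: (@le_trans _ _ (breg (x T) T)).
    apply: breg_nonincreasing => // u Tu _; apply: flow_in_ball.
    by rewrite ltW // (le_lt_trans T0).
  by rewrite /breg; have := fenchel _ T0; lra.
have := le_trans (breg_ge _ _ t0 (x_dom _ T0)) le_0.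
rewrite pmulr_rle0 // => pow0.
have /eqP : `|x t - x T| `^ p = 0 by apply/eqP; rewrite eq_le pow0 powR_ge0.
by rewrite powR_eq0 => /andP[/eqP-> _].
Qed.

Lemma flow_cvg_solution : exists2 v, S v & F v = y /\
  forall e, 0 < e -> exists2 t0, 0 <= t0 & forall t, t0 <= t -> `|x t - v| < e.
Proof.
have [[T T0 rT]|nres] := pselect (exists2 T, 0 <= T & residual T = 0).
  exact: flow_cvg_of_residual0 rT.
have res_gt0 (t : R) : 0 <= t -> 0 < residual t.
  move=> t0; rewrite lt_neqAle residual_ge0 andbT eq_sym.
  by apply/eqP => r0; apply: nres; exists t.
have recP (n : nat) : exists t, [/\ n%:R <= t, residual t < n.+1%:R^-1
    & forall s, 0 <= s -> s <= t -> residual t <= residual s].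
  apply: exists_record; rewrite ?invr_gt0 ?ltr0n //.
    by move=> b _; exact: residual_continuous.
  exact: residual_small.
have [T TP] := choice recP.
have T_ge0 n : 0 <= T n by have [+ _ _] := TP n; exact: le_trans (ler0n _ _).
set K := 1 + 3 * (1 + eta) / (1 - eta).
have K0 : 0 < K.
  rewrite /K ltr_pwDl // divr_ge0 ?subr_ge0 ?(ltW eta_lt1) //.
  by rewrite mulr_ge0 // addr_ge0.
have record s n : 0 <= s -> s <= T n ->
    breg (x (T n)) s <= K * (breg z s - breg z (T n)).
  move=> s0 sT; apply: breg_record => //; first exact: sol_in_ball.
  - by move=> u su _; apply: flow_in_ball; rewrite ltW // (le_lt_trans s0).
  - exact: flow_in_ball.
  - move=> u su uT; have [_ _] := TP n; apply=> //.
    by rewrite ltW // (le_lt_trans s0).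
have T_ge (t : R) : \forall n \near \oo, t <= T n.
  have := nbhs_infty_ger t; apply: filterS => n tn.
  by have [+ _ _] := TP n; exact: le_trans.
have small e : 0 < e -> exists2 t, 0 <= t & forall s u, t <= s -> t <= u ->
    K * (breg z s - breg z u) < c0 * e `^ p.
  move=> e0; have d0 : 0 < c0 * e `^ p / K.
    by rewrite divr_gt0 // mulr_gt0 // powR_gt0.
  have [t t0 tP] := breg_eventually _ d0; exists t => // s u ts tu.
  by rewrite mulrC -ltr_pdivlMr //; exact: tP.
have dist_lt (s : R) v e : 0 <= s -> E v -> 0 < e -> breg v s < c0 * e `^ p ->
    `|x s - v| < e.
  move=> s0 Ev e0 lt; apply: (@powR_lt_cancel _ p); rewrite ?normr_ge0 ?(ltW e0) //.
    by rewrite ltW // (lt_trans _ p_gt1).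
  rewrite -(ltr_pM2l c0_gt0); exact: le_lt_trans (breg_ge _ _ s0 Ev) lt.
(* The record bound must be based at the earlier of two times. The times T n are not known to be
   ordered, hence the two cases. *)
have cauchy_xT : cauchy ((x \o T) @ \oo).
  apply: cauchy_exP => e e0; have [t t0 tP] := small _ e0.
  have [n tn] := filter_ex (T_ge t); exists (x (T n)).
  have := T_ge t; apply: filterS => m tm; rewrite /= -ball_normE /=.
  have [nm|mn] := leP (T n) (T m).
    apply: dist_lt => //; first exact: x_dom.
    by apply: le_lt_trans (record _ _ _ nm) _ => //; exact: tP.
  rewrite distrC; apply: dist_lt => //; first exact: x_dom.
  by apply: le_lt_trans (record _ _ _ (ltW mn)) _ => //; exact: tP.
have /cauchy_cvgP/cvg_ex[v xTv] := cauchy_xT.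
(* Passage to the limit in the record bound at a fixed base time s, which need not be a record time.
   The shift by N discards the indices with T n possibly below s. *)
have v_lim (s b : R) : 0 <= s ->
    (forall u, s <= u -> K * (breg z s - breg z u) <= b) -> E v /\ breg v s <= b.
  move=> s0 le_b; have [N _ NP] := T_ge s.
  have cvg_shift : (fun n => x (T (n + N)%N)) @ \oo --> v.
    by have := xTv; rewrite -(cvg_shiftn N).
  have le_a n : th (x (T (n + N)%N)) <= b + ip (xi s) (x (T (n + N)%N)) - cs s.
    have sT : s <= T (n + N)%N by apply: NP => /=; rewrite leq_addl.
    have := le_trans (record _ _ s0 sT) (le_b _ sT).
    by rewrite /breg; lra.
  have cvg_a : (fun n => b + ip (xi s) (x (T (n + N)%N)) - cs s) @ \oo
      --> b + ip (xi s) v - cs s.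
    apply: cvgB; last exact: cvg_cst.
    by apply: cvgD; [exact: cvg_cst|exact: (ip_cvgr ipP)].
  have [Ev le_v] := th_lsc _ _ _ _ (fun n => x_dom _ (T_ge0 _)) cvg_shift le_a cvg_a.
  by split=> //; move: le_v; rewrite /breg; lra.
(* The base time 0, with nonnegativity of [breg z], supplies a finite bound and hence [E v]. *)
have [Ev _] : E v /\ breg v 0 <= K * breg z 0.
  apply: v_lim => // u u0; rewrite ler_pM2l // gerBl; exact: breg_ge0.
have Sv : S v.
  apply/SE; split=> //.
  have lim_x0 : (fun n => `|x (T n) - x0|) @ \oo --> `|v - x0|.
    by apply: cvg_norm; apply: cvgB => //; exact: cvg_cst.
  apply: (cvgr_to_le lim_x0); apply: nearW => n.
  by have /SE[] := flow_in_ball _ (T_ge0 n).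
exists v => //; split.
  have lim1 : (fun n => F (x (T n))) @ \oo --> F v.
    move=> P /(F_cont _ Sv) SP.
    have {}SP : nbhs v (fun u => S u -> P (F u)) by exact: SP.
    have xP : \forall n \near \oo, S (x (T n)) -> P (F (x (T n))) by exact: xTv SP.
    by apply: filterS xP => n; apply; exact: flow_in_ball.
  have lim2 : (fun n => F (x (T n))) @ \oo --> y.
    apply/cvgrPdist_lt => e e0.
    have := near_infty_natSinv_lt (PosNum e0); apply: filterS => n /= ne.
    by have [_ + _] := TP n; rewrite /residual distrC => /lt_trans; exact.
  exact: (cvg_unique _ lim1 lim2).
move=> e e0.
(* The limit bound is not strict; using e / 2 recovers the strict inequality for e. *)
have e20 : 0 < e / 2 by rewrite divr_gt0.
have [t t0 tP] := small _ e20; exists t => // s ts.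
have s0 : 0 <= s by exact: le_trans ts.
have [_ le_v] : E v /\ breg v s <= c0 * (e / 2) `^ p.
  by apply: v_lim => // u su; rewrite ltW // tP // (le_trans ts).
apply: dist_lt => //; apply: le_lt_trans le_v _.
rewrite ltr_pM2l //; apply: gt0_ltr_powR; rewrite ?nnegrE ?ltW //.
  by rewrite (lt_trans _ p_gt1).
by rewrite ltr_pdivrMr // ltr_pMr // ltr1n.
Qed.

End DualFlow.

(** * Convergence for the extended-valued functional *)

Theorem theorem3p5 (R : realType)
  (X Y : completeNormedModType R)
  (ipX : X -> X -> R) (ipY : Y -> Y -> R)
  (DF : set X) (F : X -> Y) (y : Y)
  (Th : X -> \bar R) (p c0 rho C0 eta : R)
  (x0 xi0 xstar : X)
  (L : X -> {linear X -> Y})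
  (xi x : R -> X) :
  inner_product ipX -> inner_product ipY ->
  (* (a) *)
  proper_fun Th -> weakly_lsc ipX Th -> 1 < p -> 0 < c0 ->
  (forall xb xx xx', edom Th xb -> dom_subdiff ipX Th xx ->
     subdiff ipX Th xx xx' ->
     ((c0 * (`|xx - xb| `^ p))%:E <= bregman ipX Th xx' xb xx)%E) ->
  (* (b) *)
  0 < rho -> subdiff ipX Th x0 xi0 ->
  cball x0 (2 * rho) `<=` DF ->
  DF xstar -> F xstar = y -> edom Th xstar ->
  (bregman ipX Th xi0 xstar x0 <= (c0 * rho `^ p)%:E)%E ->
  (* (c) *)
  {within DF, continuous F} -> weakly_closed ipX ipY DF F ->
  (* (d) *)
  (forall u, cball x0 (2 * rho) u -> edom Th u ->
     forall e : R, 0 < e -> exists2 d : R, 0 < d &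
       forall v, cball x0 (2 * rho) v -> edom Th v -> `|v - u| < d ->
         forall z, `|L v z - L u z| <= e * `|z|) ->
  0 <= eta -> eta < 1 ->
  (forall u ub, cball x0 (2 * rho) u -> edom Th u ->
     cball x0 (2 * rho) ub -> edom Th ub ->
     `|F u - F ub - L ub (u - ub)| <= eta * `|F u - F ub|) ->
  0 < C0 ->
  (forall u, cball x0 (2 * rho) u -> edom Th u ->
     forall z, `|L u z| <= C0 * `|z|) ->
  (* the flow *)
  xi 0 = xi0 -> x 0 = x0 ->
  {within [set t | 0 <= t], continuous xi} ->
  (forall t, 0 < t -> derivable xi t 1 /\
     forall z, ipX ('D_1 xi t) z = - ipY (F (x t) - y) (L (x t) z)) ->
  (forall t, 0 <= t -> is_gradient ipX (conj_fun ipX Th) (xi t) (x t)) ->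
  exists2 xb : X, (cball x0 (2 * rho) xb /\ edom Th xb) & 
    (F xb = y /\ (fun T => `|x T - xb|) @ +oo --> (0 : R)).
Proof.
move=> ipXP ipYP Th_proper Th_lsc p1 c00 pconv rho0 xi0P ballDF DFs Fs Ths le0.
move=> F_cont _ _ eta0 eta1 cone C00 L_bound xi_init x_init xi_cont xi_der gradP.
pose E := edom Th; pose th v := fine (Th v).
pose cs t := fine (conj_fun ipX Th (xi t)).
have finE v : E v -> Th v \is a fin_num.
  by move=> Ev; rewrite fin_numE (Th_proper.1 v) /= -ltey.
have grad t (t0 : 0 <= t) := conj_fun_gradient ipXP Th_proper (gradP t t0) Th_lsc.
have sub t (t0 : 0 <= t) := gradient_subdiff ipXP Th_proper (gradP t t0) Th_lsc.
have x_dom (t : R) : 0 <= t -> E (x t).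
  by move=> /grad[fin _]; rewrite /E /edom /= ltey_eq fin.
have fenchel (t : R) : 0 <= t -> th (x t) + cs t = ipX (xi t) (x t).
  by move=> /grad[].
(* The Fenchel identity replaces Th(x t) by the conjugate, which identifies the real-valued [breg]
   with the Bregman distance of the hypotheses. *)
have bregE (t : R) v : 0 <= t -> E v ->
    (bregman ipX Th (xi t) v (x t) = (@breg _ _ ipX th cs xi v t)%:E)%E.
  move=> t0 Ev; rewrite /bregman -(fineK (finE _ Ev)) -(fineK (finE _ (x_dom _ t0))).
  rewrite -!EFinB /breg -/(th v) -/(th (x t)); congr EFin.
  by have := fenchel _ t0; rewrite (ipBr ipXP); lra.
have breg_ge (t : R) v : 0 <= t -> E v ->
    c0 * `|x t - v| `^ p <= @breg _ _ ipX th cs xi v t.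
  move=> t0 Ev; rewrite -lee_fin -bregE //; apply: pconv => //; last exact: sub.
  by split; [exact: x_dom|exists (xi t); exact: sub].
have xi_derive (t : R) : 0 < t -> is_derive t (1 : R) xi ('D_1 xi t).
  by move=> /xi_der[/derivableP].
pose S := [set u | cball x0 (2 * rho) u /\ E u].
have th_lsc (u : nat -> X) (a : nat -> R) v l : (forall n, E (u n)) ->
    u @ \oo --> v -> (forall n, th (u n) <= a n) -> a @ \oo --> l -> E v /\ th v <= l.
  move=> Eu uv le_a al.
  (* The bound is proved in the extended reals first: [fine] sends [+oo] to 0, so a bound on [th v]
     alone would not give [E v]. *)
  have le_l : (Th v <= l%:E)%E.
    apply: le_trans (Th_lsc _ _ (strong_weak_cvg ipXP _ _ uv)) _.
    apply: (limn_einf_le_cvg _ _ _ _ al) => n.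
    by rewrite -(fineK (finE _ (Eu n))) lee_fin; exact: le_a.
  have Ev : E v by exact: le_lt_trans le_l (ltry _).
  by split=> //; rewrite -lee_fin fineK // finE.
have F_contS u : S u -> F @ within S (nbhs u) --> F u.
  move=> [bu _] P /((subspace_continuousP _ _).1 F_cont _ (ballDF _ bu)) FP.
  have {}FP : nbhs u (fun v => DF v -> P (F v)) by exact: FP.
  have : nbhs u (fun v => S v -> P (F v)).
    by apply: filterS FP => v h [bv _]; apply: h; exact: ballDF.
  exact.
have z_near : @breg _ _ ipX th cs xi xstar 0 <= c0 * rho `^ p.
  by rewrite -lee_fin -bregE // xi_init x_init.
have [v [bv Ev] [Fv lim]] := @flow_cvg_solution R X ipX E th cs xi (fun t => 'D_1 xi t)
  x c0 p ipXP c00 p1 x_dom fenchel breg_ge xi_cont xi_derive Y ipY F y L S eta ipYP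
  eta0 eta1 (fun u v Su Sv => cone u v Su.1 Su.2 Sv.1 Sv.2)
  (fun t t0 => (xi_der t t0).2) xstar x0 rho C0 (fun u => iff_refl _) rho0 x_init
  Ths Fs z_near (ltW C00) (fun u Su => L_bound u Su.1 Su.2) F_contS th_lsc.
exists v => //; split=> //; apply/cvgrPdist_lt => e e0.
have [t t0 tP] := lim _ e0.
have := nbhs_pinfty_ge (num_real t); apply: filterS => s /tP.
by rewrite sub0r normrN normr_id.
Qed.
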